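(* For every curve $\gamma\in Lip_{\mathfrak{Z}}([0,1];\mathbb{R}^N)$ one has $$L(\gamma)=E(\gamma),$$ as an equality in $[0,\infty]$.
   Context: Let $N\ge 2$, $m\ge 2$, and let $W:\mathbb{R}^N\to[0,\infty)$ be a continuous function such that: (i) its zero set is $\mathfrak{Z}=\{\mathbf{p}_1,\dots,\mathbf{p}_m\}$, consisting of $m$ distinct points, and $W>0$ elsewhere; (ii) $\liminf_{|p|\to\infty}W(p)>0$. Set $F:=\sqrt{W}$. For a continuous curve $\gamma:[0,1]\to\mathbb{R}^N$ put $\mathcal{T}_\gamma:=\{t\in[0,1]:\gamma(t)\in\mathfrak{Z}\}$. The class $Lip_{\mathfrak{Z}}([0,1];\mathbb{R}^N)$ consists of all continuous $\gamma:[0,1]\to\mathbb{R}^N$ that are locally Lipschitz (Euclidean metric) on $[0,1]\setminus\mathcal{T}_\gamma$. For $p,q\in\mathbb{R}^N$, $Lip_{\mathfrak{Z}}(p,q)$ is the set of $\gamma\in Lip_{\mathfrak{Z}}([0,1];\mathbb{R}^N)$ with $\gamma(0)=p$, $\gamma(1)=q$. For $\gamma\in Lip_{\mathfrak{Z}}([0,1];\mathbb{R}^N)$ define $E(\gamma):=\int_0^1F(\gamma(t))|\gamma'(t)|\,dt\in[0,\infty]$, where the integrand is taken to be $0$ at times $t\in\mathcal{T}_\gamma$ (where $F(\gamma(t))=0$). The metric $d$ on $\mathbb{R}^N$ is $d(p,q):=\inf\{E(\gamma):\gamma\in Lip_{\mathfrak{Z}}(p,q)\}$. The length of a curve $\gamma:[0,1]\to\mathbb{R}^N$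 is $$L(\gamma):=\sup\sum_{j=0}^{J-1}d(\gamma(t_j),\gamma(t_{j+1}))\in[0,\infty],$$ the supremum being over all finite partitions $0=t_0<t_1<\dots<t_J=1$ of $[0,1]$. *)

(* Defs.v *)
From HB Require Import structures.
From mathcomp Require Import all_boot all_order all_algebra.
From mathcomp Require Import all_classical all_reals all_analysis.

Set Implicit Arguments.
Unset Strict Implicit.
Unset Printing Implicit Defensive.

Import Order.TTheory GRing.Theory Num.Theory.
Import numFieldNormedType.Exports.

Local Open Scope classical_set_scope.
Local Open Scope ring_scope.

(* The library norm `|x| on 'rV[R]_N is the max norm: it supplies the topology
   and the derivative of curves, whereas lengths are measured with enorm. *)
Definition enorm (R : realType) (N : nat) (x : 'rV[R]_N) : R :=
  Num.sqrt (\sum_(i < N) x ord0 i ^+ 2).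

(* The filter "|p| -> +oo" on R^N. *)
Definition at_infinity (R : realType) (N : nat) : set_system 'rV[R]_N :=
  [set A | exists M : R, forall p : 'rV[R]_N, M < enorm p -> A p].

Definition zeros (R : realType) (N : nat) (W : 'rV[R]_N -> R) :
  set 'rV[R]_N := [set p | W p = 0].

(* Curves [0,1] -> R^N are represented by total functions R -> R^N, whose
   values outside [0,1] are irrelevant to all the notions below. *)
Definition zero_times (R : realType) (N : nat) (W : 'rV[R]_N -> R)
  (gamma : R -> 'rV[R]_N) : set R := `[0, 1] `&` gamma @^-1` zeros W.

Definition locally_lipschitz_on (R : realType) (N : nat) (A : set R)
  (gamma : R -> 'rV[R]_N) : Prop :=
  forall t, A t -> exists (k : R) (U : set R), nbhs t U /\
    forall s s', (A `&` U) s -> (A `&` U) s' ->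
      enorm (gamma s - gamma s') <= k * `|s - s'|.

Definition LipZ (R : realType) (N : nat) (W : 'rV[R]_N -> R) :
  set (R -> 'rV[R]_N) :=
  [set gamma : R -> 'rV[R]_N | {within `[(0 : R), 1], continuous gamma} /\
     locally_lipschitz_on (`[0, 1] `\` zero_times W gamma) gamma].

Definition LipZ_from_to (R : realType) (N : nat) (W : 'rV[R]_N -> R)
  (p q : 'rV[R]_N) : set (R -> 'rV[R]_N) :=
  [set gamma | [/\ LipZ W gamma, gamma 0 = p & gamma 1 = q]].

(* The derivative is a total function, so at zero times the integrand is
   0 * _ = 0 whether or not gamma is differentiable there.  Off the zero times,
   gamma is differentiable almost everywhere, and the default value of the
   derivative at the remaining times does not affect the integral. *)
Definition energy (R : realType) (N : nat) (W : 'rV[R]_N -> R)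
  (gamma : R -> 'rV[R]_N) : \bar R :=
  (\int[lebesgue_measure]_(t in `[0%R, 1%R])
     (Num.sqrt (W (gamma t)) * enorm (derive1 gamma t))%:E)%E.

Definition dist_W (R : realType) (N : nat) (W : 'rV[R]_N -> R)
  (p q : 'rV[R]_N) : \bar R :=
  ereal_inf (energy W @` LipZ_from_to W p q).

(* itv_partition 0 1 s means that 0 :: s is strictly increasing with last
   element 1, so that t_j = nth 1 (0 :: s) j for 0 <= j <= J = size s. *)
Definition curve_length (R : realType) (N : nat) (W : 'rV[R]_N -> R)
  (gamma : R -> 'rV[R]_N) : \bar R :=
  ereal_sup
    [set (\sum_(0 <= j < size s)
            dist_W W (gamma (nth 1%R (0%R :: s) j))
                     (gamma (nth 1%R (0%R :: s) j.+1)))%E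
    | s in [set s : seq R | itv_partition 0 1 s]].

(* Main.v *)
Require Import Defs.
From HB Require Import structures.
From mathcomp Require Import all_boot all_order all_algebra.
From mathcomp Require Import all_classical all_reals all_analysis.
From mathcomp Require Import measurable_realfun.
From mathcomp Require Import ring lra.
Import Order.TTheory GRing.Theory Num.Theory.
Import numFieldNormedType.Exports.
Local Open Scope classical_set_scope.
Local Open Scope ring_scope.

(** Both inequalities compare the integrand [sqrt (W (g t)) * |g' t|] with the
    distance [d] that it defines.

    Length is at most energy: for [a < b] the restriction of [g] to [[a, b]],
    reparametrized affinely, is a competitor in the definition of
    [d (g a, g b)], so this distance is at most the energy of [g] over [[a, b]]
    ([dist_le_integral]); summing over a partition gives
    [curve_length_le_energy].

    Energy is at most length: the density is bounded by the lower limit of the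
    difference quotients of [d] along [g]. If [sqrt W >= c > 0] on the ball of
    centre [p] and radius [|q - p|], then [d (p, q) >= c |q - p|], since any
    curve from [p] to [q] must travel a Euclidean distance [|q - p|] before
    leaving that ball ([dist_ge]). By continuity of [W], at a time [t] where [g]
    is derivable and [W (g t) > 0] this gives, for short intervals [[a, b]]
    containing [t], [d (g a, g b) / (b - a) >= sqrt (W (g t)) * |g' t| - o(1)]
    ([dist_ge_speed]). Let [step_speed n] be the step function equal to
    [d (g a, g b) / (b - a)] on each interval of the uniform partition into
    [n + 1] intervals. Its integral is a polygonal sum, hence at most the
    length, and its lower limit is at least the density
    ([energy_density_le_liminf]); Fatou's lemma concludes ([energy_le_curve_length]).

    The analytic input is that a Lipschitz curve satisfies
    [|g b - g a| <= int_a^b |g'|] ([ler_enorm_integral_speed]), which rests on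
    the fundamental theorem of calculus for real Lipschitz functions
    ([lipschitz_FTC]), and that the derivative of a continuous curve, with its
    default value where it does not exist, is Borel
    ([measurable_fun_derive1]). *)

Set Implicit Arguments.
Unset Strict Implicit.
Unset Printing Implicit Defensive.

(** * The Euclidean norm *)

Section EuclideanNorm.
Context {R : realType} {N : nat}.
Implicit Types x y : 'rV[R]_N.

Definition edot x y : R := \sum_(i < N) x ord0 i * y ord0 i.

Lemma enorm_ge0 x : 0 <= enorm x.
Proof. exact: sqrtr_ge0. Qed.

Lemma enorm_sqr x : enorm x ^+ 2 = edot x x.
Proof.
rewrite /enorm sqr_sqrtr; last by apply: sumr_ge0 => i _; exact: sqr_ge0.
by apply: eq_bigr => i _; rewrite expr2.
Qed.

Lemma enorm0 : enorm (0 : 'rV[R]_N) = 0.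
Proof.
by rewrite /enorm big1 ?sqrtr0// => i _; rewrite mxE expr0n.
Qed.

Lemma coord_le_enorm x i : `|x ord0 i| <= enorm x.
Proof.
rewrite -sqrtr_sqr ler_wsqrtr// (bigD1 i)//= lerDl.
by apply: sumr_ge0 => j _; exact: sqr_ge0.
Qed.

Lemma enorm_eq0 x : enorm x = 0 -> x = 0.
Proof.
move=> x0; apply/rowP => i; rewrite mxE; apply/eqP.
by rewrite -normr_eq0 eq_le normr_ge0 andbT -x0 coord_le_enorm.
Qed.

Lemma enormZ (a : R) x : enorm (a *: x) = `|a| * enorm x.
Proof.
rewrite /enorm -sqrtr_sqr -sqrtrM ?sqr_ge0//; congr Num.sqrt.
by rewrite mulr_sumr; apply: eq_bigr => i _; rewrite mxE exprMn.
Qed.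

Lemma enormN x : enorm (- x) = enorm x.
Proof. by rewrite -scaleN1r enormZ normrN1 mul1r. Qed.

Lemma enormBC x y : enorm (x - y) = enorm (y - x).
Proof. by rewrite -enormN opprB. Qed.

(** Cauchy-Schwarz, from the nonnegativity of [|| |x| y - |y| x ||^2]. *)
Lemma edot_le x y : edot x y <= enorm x * enorm y.
Proof.
have [x0|x0] := eqVneq (enorm x) 0.
  rewrite x0 mul0r (enorm_eq0 x0) /edot big1// => i _.
  by rewrite mxE mul0r.
have [y0|y0] := eqVneq (enorm y) 0.
  rewrite y0 mulr0 (enorm_eq0 y0) /edot big1// => i _.
  by rewrite mxE mulr0.
have xy0 : 0 < enorm x * enorm y.
  by rewrite mulr_gt0// lt_def enorm_ge0 ?x0 ?y0.
set a := enorm x; set b := enorm y.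
have : 0 <= \sum_(i < N) (b * x ord0 i - a * y ord0 i) ^+ 2.
  by apply: sumr_ge0 => i _; exact: sqr_ge0.
have -> : \sum_(i < N) (b * x ord0 i - a * y ord0 i) ^+ 2 =
    b ^+ 2 * edot x x - (a * b *+ 2) * edot x y + a ^+ 2 * edot y y.
  rewrite /edot !mulr_sumr -sumrB -big_split/=.
  by apply: eq_bigr => i _; ring.
rewrite -!enorm_sqr -/a -/b => H.
rewrite -(ler_pM2l xy0) -/a -/b.
nra.
Qed.

Lemma ler_enormD x y : enorm (x + y) <= enorm x + enorm y.
Proof.
rewrite -(@ler_pXn2r _ 2)// ?nnegrE ?addr_ge0 ?enorm_ge0//.
have -> : enorm (x + y) ^+ 2 = enorm x ^+ 2 + (edot x y) *+ 2 + enorm y ^+ 2.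
  rewrite !enorm_sqr /edot -sumrMnl -!big_split/=.
  by apply: eq_bigr => i _; rewrite !mxE; ring.
have := edot_le x y; nra.
Qed.

Lemma ler_enormB x y : enorm x - enorm y <= enorm (x - y).
Proof. by rewrite lerBlDr -[in leLHS](subrK y x) ler_enormD. Qed.

Lemma mx_norm_le_enorm x : `|x| <= enorm x.
Proof.
rewrite [leLHS](_ : _ = mx_norm x)// mx_normrE.
apply/bigmax_leP; split; first exact: enorm_ge0.
by move=> [i j] _ /=; rewrite ord1 coord_le_enorm.
Qed.

Lemma enorm_le_mx_norm x : enorm x <= N%:R * `|x|.
Proof.
have H i : `|x ord0 i| <= `|x|.
  rewrite [leRHS](_ : _ = mx_norm x)// mx_normrE.
  exact: (le_bigmax _ (fun i : 'I_1 * 'I_N => `|x i.1 i.2|) (ord0, i)).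
rewrite -(@ler_pXn2r _ 2)// ?nnegrE ?mulr_ge0 ?enorm_ge0//.
rewrite enorm_sqr exprMn.
apply: (@le_trans _ _ (\sum_(i < N) `|x| ^+ 2)).
  apply: ler_sum => i _; rewrite -expr2 -real_normK ?num_real//.
  by rewrite ler_pXn2r// nnegrE.
rewrite sumr_const card_ord -[leLHS]mulr_natl.
apply: ler_wpM2r; first exact: sqr_ge0.
by rewrite -natrX ler_nat; case: (N) => // n;
  rewrite expnS leq_pmulr// expn_gt0.
Qed.

Lemma ler_dist_enorm x y : `|enorm x - enorm y| <= enorm (x - y).
Proof.
have [xy|xy] := leP (enorm y) (enorm x).
  by rewrite ger0_norm ?subr_ge0//; exact: ler_enormB.
by rewrite ltr0_norm ?subr_lt0// opprB enormBC; exact: ler_enormB.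
Qed.

Lemma continuous_enorm : continuous (@enorm R N).
Proof.
move=> x; apply/(@cvgrPdist_le _ _ _ _ (nbhs_filter x)) => e e0.
have eN0 : 0 < e / N.+1%:R by rewrite divr_gt0.
have : \forall y \near x, `|x - y| < e / N.+1%:R 
  by apply/nbhs_normP; exists (e / N.+1%:R).
apply: filterS => y xy; apply: (le_trans (ler_dist_enorm _ _)).
apply: (le_trans (enorm_le_mx_norm _)).
apply: (@le_trans _ _ (N.+1%:R * (e / N.+1%:R))).
  by apply: ler_pM => //; [rewrite ler_nat|exact: ltW].
by rewrite mulrC divfK// pnatr_eq0.
Qed.

End EuclideanNorm.

(** * Stieltjes measures of Lipschitz functions *)

Section LipschitzStieltjes.
Context {R : realType}.
Notation mu := (@lebesgue_measure R).
Local Open Scope ereal_scope.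

Lemma lipschitz_continuous {V : normedModType R} (f : R -> V) (K : R) :
  (forall x y, `|f x - f y| <= K * `|x - y|)%R -> continuous f.
Proof.
move=> fK x; apply/cvgrPdist_le => e e0.
have eK : (0 < e / (`|K| + 1))%R by rewrite divr_gt0// ltr_wpDl.
have : \forall y \near x, (`|x - y| < e / (`|K| + 1))%R.
  by apply/nbhs_normP; exists (e / (`|K| + 1))%R.
apply: filterS => y xy; apply: (le_trans (fK _ _)).
apply: (@le_trans _ _ ((`|K| + 1) * (e / (`|K| + 1)))%R).
  apply: ler_pM => //; last exact: ltW.
    rewrite leNgt; apply/negP => K0.
    have := fK x (x + 1)%R; rewrite opprD addrA subrr sub0r normrN normr1 mulr1.
    by move=> /(le_trans (normr_ge0 _)); rewrite leNgt K0.
  by rewrite (le_trans (ler_norm _))// lerDl.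
by rewrite mulrC divfK// gt_eqF// ltr_wpDl.
Qed.

Lemma stieltjes_itv (G : cumulative R R) (x y : R) : (x <= y)%R ->
  lebesgue_stieltjes_measure G `]x, y]%classic = (G y - G x)%:E.
Proof.
move=> xy; rewrite /lebesgue_stieltjes_measure /measure_extension.
rewrite measurable_mu_extE/=.
  by rewrite wlength_itv_bnd.
by exists (x, y).
Qed.

(** If [G] grows at rate at most [M], then [x |-> M x - G x] is again
    nondecreasing, and its Stieltjes measure is what must be added to that of
    [G] to obtain [M] times Lebesgue measure. *)
Lemma stieltjes_lipschitz_le (G : cumulative R R) (M : R) : (0 < M)%R ->
  (forall x y, x <= y -> G y - G x <= M * (y - x))%R ->
  forall A : set (measurableTypeR R), measurable A ->
  lebesgue_stieltjes_measure G A <= M%:E * mu A.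
Proof.
move=> M0 GM A mA.
pose h x := (M * x - G x)%R.
have h_nd : nondecreasing h.
  move=> x y xy; rewrite /h; have := GM _ _ xy; lra.
have h_c : right_continuous h.
  apply: right_continuousW.
  apply: (@lipschitz_continuous _ _ (M + M)%R).
  have H x y : (x <= y)%R -> (`|h x - h y| <= (M + M) * `|x - y|)%R.
    move=> xy; rewrite ler_norml /h ler0_norm ?subr_le0//.
    have := GM _ _ xy.
    have := cumulative_is_nondecreasing G _ _ xy.
    have : (0 <= M * (y - x))%R by rewrite mulr_ge0 ?subr_ge0// ltW.
    by move=> *; apply/andP; split; lra.
  move=> x y; have [xy|/ltW yx] := leP x y; first exact: H.
  by rewrite distrC (distrC x y); exact: H.
pose H : cumulative R R := HB.pack h (isCumulative.Build _ _ _ h h_nd h_c).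
pose nu := measure_add (lebesgue_stieltjes_measure G)
                       (lebesgue_stieltjes_measure H).
have Mi : (0 <= M^-1)%R by rewrite invr_ge0 ltW.
have E : mu A = mscale (NngNum Mi) nu A.
  apply: lebesgue_measure_unique => //.
  move=> X [[x y] _ <-] /=.
  have [xy|yx] := leP x y; last first.
    by rewrite set_itv_ge// ?bnd_simp -?leNgt ?ltW// !measure0.
  rewrite [RHS](_ : _ = M^-1%:E * nu `]x, y]%classic)//.
  rewrite /nu measure_addE /lebesgue_measure/= !stieltjes_itv//=.
    rewrite -EFinD -EFinM; congr EFin; rewrite /h.
  by field; rewrite gt_eqF.
rewrite E [X in _ <= _ * X](_ : _ = M^-1%:E * nu A)// muleA -EFinM.
rewrite mulfV ?gt_eqF// mul1e /nu measure_addE.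
by rewrite leeDl.
Qed.

End LipschitzStieltjes.

(** * The fundamental theorem of calculus for Lipschitz functions *)

Section LipschitzFTC.
Context {R : realType}.
Notation mu := (@lebesgue_measure R).
Local Open Scope ereal_scope.

(** Adding a large linear term makes a Lipschitz function nondecreasing; its
    Stieltjes measure is then dominated by Lebesgue measure, so it has a
    Radon-Nikodym density, whose primitive is differentiable almost everywhere
    by the Lebesgue differentiation theorem. *)
Lemma lipschitz_FTC (f : R -> R) (K a b : R) : (a < b)%R ->
  (forall x y, `|f x - f y| <= K * `|x - y|)%R ->
  exists phi : R -> R, [/\ mu.-integrable `]a, b]%classic (EFin \o phi),
    (f b - f a)%:E = \int[mu]_(x in `]a, b]) (phi x)%:E &
    {ae mu, forall x, `]a, b[%classic x -> is_derive x 1%R f (phi x)}].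
Proof.
move=> ab fK.
pose k := (`|K| + 1)%R.
have k0 : (0 < k)%R by rewrite /k ltr_wpDl.
have fk x y : (x <= y)%R -> (`|f y - f x| <= k * (y - x))%R.
  move=> xy; apply: (le_trans (fK _ _)); rewrite ger0_norm ?subr_ge0//.
  rewrite ler_wpM2r ?subr_ge0// /k (le_trans (ler_norm K))// lerDl//.
pose g x := (f x + k * x)%R.
have g_nd : nondecreasing g.
  by move=> x y xy; have := fk _ _ xy; rewrite ler_norml /g => /andP[]; lra.
have g_c : right_continuous g.
  apply: right_continuousW; move=> x; apply: cvgD.
    exact: (lipschitz_continuous fK).
  by apply: cvgM; [exact: cvg_cst|exact: cvg_id].
pose G : cumulative R R := HB.pack g (isCumulative.Build _ _ _ g g_nd g_c).
have GM x y : (x <= y)%R -> (G y - G x <= (k + k) * (y - x))%R.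
  by move=> xy; have := fk _ _ xy; rewrite ler_norml /= /g => /andP[]; lra.
pose nu := lebesgue_stieltjes_measure G.
pose D : set (measurableTypeR R) := `]a, b]%classic.
have mD : measurable D by exact: measurable_itv.
have muD : mu D = (b - a)%:E.
  by rewrite /D lebesgue_measure_itv/= lte_fin ab -EFinB.
have nuD : nu D < +oo.
  by rewrite /nu /D stieltjes_itv ?ltry// ltW.
pose nuD' := mfrestr mD nuD.
have dom : nuD' `<< mu.
  apply/null_content_dominatesP => A mA A0.
  apply/eqP; rewrite eq_le measure_ge0 andbT.
  apply: (@le_trans _ _ (nu A)).
    by apply: le_measure; rewrite ?inE//; exact: measurableI.
  have := stieltjes_lipschitz_le (addr_gt0 k0 k0) GM mA.
  by rewrite [X in _ * X](_ : _ = 0)// mule0.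
have [psi [psi0 psifin psiint psiE]] := radon_nikodym_sigma_finite dom.
pose phi0 := fine \o psi.
have phi0E x : (phi0 x)%:E = psi x by rewrite /phi0/= fineK.
have phi0EE : EFin \o phi0 = psi by apply/funext => x /=; rewrite phi0E.
have intphi0 E : measurable E -> mu.-integrable E (EFin \o phi0).
  by move=> mE; rewrite phi0EE; apply: integrableS psiint.
exists (fun x => phi0 x - k)%R.
have intk : mu.-integrable D (EFin \o (fun=> k)).
  apply: measurable_bounded_integrable => //.
    by rewrite [ltLHS]muD ltry.
  by exists `|k|%R; split => // M kM x _ /=; exact: ltW.
have nuE x : (a <= x <= b)%R -> \int[mu]_(y in `]a, x]) psi y = (G x - G a)%:E.
  move=> /andP[ax xb]; rewrite -psiE//.
  rewrite [LHS](_ : _ = nu (`]a, x]%classic `&` D))// setIidl.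
    by rewrite /nu stieltjes_itv// ltW.
  move=> z; rewrite /D/= !in_itv/= => /andP[-> zx]; exact: (le_trans zx).
split.
- have := integrableB mD (intphi0 _ mD) intk.
  by congr (integrable _ _ _); apply/funext => x /=.
- under eq_integral do rewrite EFinB.
  rewrite integralB_EFin//; last exact: intphi0.
  under eq_integral do rewrite phi0E.
  rewrite nuE ?lexx ?ltW// integral_cst//= [X in _ * X]muD.
  by rewrite -EFinM -EFinB /g; congr EFin; ring.
(* The primitive of [phi0] starts at -oo while the density was only computed
   between [a] and [b]: its part outside vanishes, because the measure was
   restricted to that interval. *)
- have psi_out : \int[mu]_(y in ~` D) psi y = 0.
    rewrite -psiE; last exact: measurableC.
    by rewrite [LHS](_ : _ = nu (~` D `&` D))// setICl /nu measure0.
  have locphi : locally_integrable [set: R] phi0.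
    have [mphi _] := integrableP _ _ _ (intphi0 _ measurableT).
    split; [exact/measurable_EFinP|exact: openT|].
    move=> C _ cC; have mC : measurable C by exact: compact_measurable.
    by have /integrableP[] := intphi0 _ mC.
  have := FTC1Ny (fun y => intphi0 _ (measurable_itv `]-oo, y])) locphi.
  apply: (@filterS _ _ (ae_filter_ringOfSetsType mu))
    => x [dF F'] /=; rewrite in_itv/= => /andP[ax xb].
  set F := (F in derivable F x 1) in dF F'.
  have FG y : (a < y < b)%R -> F y = (G y - G a)%R.
    move=> /andP[ay yb]; rewrite /F /Rintegral.
    under eq_integral do rewrite phi0E.
    have -> : `]-oo, y]%classic = `]-oo, a]%classic `|` `]a, y]%classic.
      by rewrite -itv_bndbnd_setU// bnd_simp ltW.
    rewrite ge0_integral_setU//=.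
    - rewrite nuE ?(ltW ay) ?(ltW yb)//.
      rewrite [X in (X + _)](_ : _ = 0) ?add0e//.
      apply/eqP; rewrite eq_le integral_ge0// andbT -psi_out.
      apply: ge0_subset_integral => //.
      + exact: measurableC.
      + apply: (measurable_funS measurableT) => //.
        exact: measurable_int psiint.
      + by move=> z /= /[!in_itv]/= za; rewrite /D/= in_itv/= ltNge za.
    - apply: (measurable_funS measurableT) => //.
      exact: measurable_int psiint.
    - apply/disj_setPS => z [/=]; rewrite !in_itv/= => za /andP[az _].
      by move: az; rewrite ltNge za.
  have dFx : is_derive x 1%R F (phi0 x).
    exact: (DeriveDef dF (etrans (esym (derive1E F x)) F')).
  have dGa : is_derive x 1%R (fun y => f y + k * y - G a)%R (phi0 x).
    apply: near_eq_is_derive dFx.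
    have : \forall y \near x, (a < y < b)%R.
      by near=> y; apply/andP; split; near: y;
          [exact: lt_nbhsr|exact: lt_nbhsl].
    by apply: filterS => y /FG ->.
  have dk : is_derive x 1%R (fun y => k * y - G a)%R k.
    have := is_deriveB (is_deriveZ k (is_derive_id x 1%R))
                      (is_derive_cst (G a) x 1%R).
    by rewrite subr0 /GRing.scale/= mulr1.
  have := is_deriveB dGa dk.
  congr (is_derive _ _ _ _).
  by apply/funext => y; rewrite !fctE /=; ring.
Unshelve. all: by end_near. Qed.

End LipschitzFTC.

(** * Measurability of derivatives *)

(** Joins the completeness of matrices, as a uniform space, with their norm. *)
HB.instance Definition _ (R : realType) (m n : nat) := Complete.on 'M[R]_(m, n).

Section MeasurableDerivative.
Context {R : realType} {V : completeNormedModType R}.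
Variables (g : R -> V) (g_cont : continuous g).

Let q t h : V := h^-1 *: (g (h + t) - g t).

Let qE t : (fun h => h^-1 *: ((g \o shift t) (h *: (1 : R)) - g t)) = q t.
Proof. by apply/funext => h; rewrite /q /= [h *: _]mulr1. Qed.

Let q_cont h : continuous (q ^~ h).
Proof.
move=> t; apply: cvgZ; first exact: cvg_cst; apply: cvgB; last exact: g_cont.
apply: (@cvg_comp _ _ _ (fun t => h + t) g); last exact: g_cont.
by apply: cvgD; [exact: cvg_cst|exact: cvg_id].
Qed.

Let C k n : set R := [set t | forall h h',
  0 < `|h| < n.+1%:R^-1 -> 0 < `|h'| < n.+1%:R^-1 ->
  `|q t h - q t h'| <= k.+1%:R^-1].

Let closed_C k n : closed (C k n).
Proof.
have -> : C k n = \bigcap_(hh in [set hh : R * R |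
    0 < `|hh.1| < n.+1%:R^-1 /\ 0 < `|hh.2| < n.+1%:R^-1])
    ((fun t => `|q t hh.1 - q t hh.2|) @^-1` [set x | x <= k.+1%:R^-1]).
  apply/seteqP; split => t /=.
    by move=> Ct [h h'] /= [hn hn']; exact: Ct.
  by move=> Ct h h' hn hn'; exact: (Ct (h, h')).
apply: closed_bigI => -[h h'] _ /=.
apply: closed_comp; last exact: closed_le.
move=> t _; apply: cvg_norm; apply: cvgB; exact: q_cont.
Qed.

(** Completeness turns derivability into a Cauchy condition on the
    difference quotients, and for each tolerance and scale that condition is a
    closed one because the quotients are continuous in the time variable. *)
Let derivable_set : [set t | derivable g t 1] = \bigcap_k \bigcup_n C k n.
Proof.
apply/seteqP; split => t /=; rewrite /derivable qE.
  move=> /cvg_cauchy/cauchy_ballP cq k _.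
  have [|[A B] /= [A0 B0] AB] := cq k.+1%:R^-1; first by rewrite invr_gt0.
  have : \forall h \near 0^', A (q t h) /\ B (q t h).
    exact: filterI A0 B0.
  move=> [e /= e0 He].
  have [n _ nP] : \forall n \near \oo, n.+1%:R^-1 < e :> R.
    exact: near_infty_natSinv_lt (PosNum e0).
  exists n => // h h' /andP[h0 hn] /andP[h'0 h'n].
  have ne := nP n (leqnn n).
  have [Ah _] : A (q t h) /\ B (q t h).
    apply: He; last by rewrite -normr_gt0.
    by rewrite /ball_/= sub0r normrN (lt_trans hn).
  have [_ Bh'] : A (q t h') /\ B (q t h').
    apply: He; last by rewrite -normr_gt0.
    by rewrite /ball_/= sub0r normrN (lt_trans h'n).
  have := AB (q t h, q t h') (conj Ah Bh').
  by rewrite -ball_normE/= => /ltW.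
move=> Ct; apply: cauchy_cvg; apply/cauchy_ballP => e e0.
have [k _ kP] : \forall k \near \oo, k.+1%:R^-1 < e :> R.
  exact: near_infty_natSinv_lt (PosNum e0).
have ke := kP k (leqnn k).
have [n _ Cn] := Ct k I.
have H : \forall h \near (0:R)^', 0 < `|h| < n.+1%:R^-1.
  exists (n.+1%:R^-1) => /=; first by rewrite invr_gt0.
  by move=> h /=; rewrite sub0r normrN normr_gt0 => -> ->.
exists ([set q t h | h in [set h : R | 0 < `|h| < n.+1%:R^-1]],
        [set q t h | h in [set h : R | 0 < `|h| < n.+1%:R^-1]]) => /=.
  by split; apply: filterS H => h hn; exists h.
move=> [_ _] /= [[h hn <-] [h' hn' <-]].
rewrite -ball_normE/=; exact: le_lt_trans (Cn _ _ hn hn') ke.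
Qed.

Lemma measurable_derivable : measurable ([set t | derivable g t 1] : set R).
Proof.
rewrite derivable_set; apply: bigcapT_measurable => k.
apply: bigcupT_measurable => n; apply: closed_measurable; exact: closed_C.
Qed.

(** Where [g] is derivable, [derive1 g] is the limit of the continuous functions
    [n.+1 *: (g (t + 1 / n.+1) - g t)]; elsewhere it is a fixed default value,
    and the set of derivability times is Borel. *)
Lemma measurable_fun_derive1 (phi : V -> R) : continuous phi ->
  measurable_fun setT (fun t => phi (derive1 g t)).
Proof.
move=> cphi.
have mD := measurable_derivable.
have <- : [set t | derivable g t 1] `|` ~` [set t | derivable g t 1] = setT.
  exact: setUv.
apply/measurable_funU => //; first exact: measurableC.
split.
  apply: (@measurable_fun_cvg _ _ _ _ (fun n t => phi (q t n.+1%:R^-1))).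
    move=> n; apply: measurable_funTS; apply: continuous_measurable_fun.
    by move=> t; apply: continuous_comp; [exact: q_cont|exact: cphi].
  move=> t /=; rewrite /derivable qE => dt.
  apply: (@cvg_comp _ _ _ (fun n => q t n.+1%:R^-1) phi _
    (nbhs (derive1 g t))); last exact: cphi.
  have : q t h @[h --> 0^'] --> derive1 g t by [].
  apply: cvg_comp => A [e /= e0 eA].
  have [n _ nP] : \forall n \near \oo, n.+1%:R^-1 < e :> R.
    exact: near_infty_natSinv_lt (PosNum e0).
  exists n => // m /nP me /=; apply: eA => /=; last by rewrite invr_neq0.
  by rewrite sub0r normrN ger0_norm.
apply: (eq_measurable_fun (cst (phi point))); last exact: measurable_cst.
move=> t; rewrite inE /= => nd; congr phi.
by rewrite derive1E /derive dvgP.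
Qed.

End MeasurableDerivative.

(** * Euclidean length of Lipschitz curves *)

Section Clamp.
Context {R : realType}.
Implicit Types a b s t : R.

Definition clamp a b t : R := Num.max a (Num.min b t).

Lemma clamp_itv a b t : a <= b -> a <= clamp a b t <= b.
Proof.
move=> ab; rewrite /clamp le_max lexx/= ge_max ab/=.
by rewrite ge_min lexx.
Qed.

Lemma clamp_id a b t : a <= t <= b -> clamp a b t = t.
Proof. by move=> /andP[at_ tb]; rewrite /clamp min_r// max_r. Qed.

Lemma clamp_lipschitz a b s t : `|clamp a b s - clamp a b t| <= `|s - t|.
Proof.
wlog st : s t / s <= t.
  move=> H; have [/H//|/ltW/H] := leP s t.
  by rewrite distrC (distrC t s).
have minst : Num.min b s <= Num.min b t.
  by rewrite le_min !ge_min lexx st orbT.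
have mints : Num.min b t - (t - s) <= Num.min b s.
  by rewrite le_min; apply/andP; split; rewrite lerBlDr ge_min;
    apply/orP; [left|right]; lra.
have cst : clamp a b s <= clamp a b t.
  by rewrite /clamp ge_max !le_max lexx minst orbT.
have cts : clamp a b t <= clamp a b s + (t - s).
  rewrite [in leLHS]/clamp ge_max; apply/andP; split.
    have : a <= clamp a b s by rewrite le_max lexx.
    by lra.
  have : Num.min b s <= clamp a b s by rewrite le_max lexx orbT.
  by lra.
rewrite distrC (distrC s) !ger0_norm ?subr_ge0//.
by lra.
Qed.

Lemma clamp_continuous a b : continuous (clamp a b).
Proof.
apply: (@lipschitz_continuous _ _ _ 1) => s t.
by rewrite mul1r clamp_lipschitz.
Qed.

(** Freezing a curve at its endpoints makes it continuous on the whole line, as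
    [measurable_fun_derive1] and [first_hit] require. *)
Lemma continuous_clamp {V : normedModType R} (g : R -> V) a b : a <= b ->
  {within `[a, b], continuous g} -> continuous (g \o clamp a b).
Proof.
move=> ab /subspace_continuousP cg t.
have ct := clamp_itv t ab.
have ctw : clamp a b s @[s --> t] --> within `[a, b] (nbhs (clamp a b t)).
  move=> A /= wA.
  have H : \forall s \near t, `[a, b]%classic (clamp a b s) -> A (clamp a b s).
    exact: (@clamp_continuous a b t _ wA).
  by apply: filterS H => s; apply; rewrite /= in_itv/= clamp_itv.
apply: (cvg_comp _ _ ctw).
by apply: cg; rewrite /= in_itv.
Qed.

Lemma near_clamp {V : normedModType R} (g : R -> V) a b t : a < t < b ->
  \forall s \near t, (g \o clamp a b) s = g s.
Proof.
move=> /andP[at_ tb].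
have : \forall s \near t, a < s < b.
  by near=> s; apply/andP; split; near: s; [exact: lt_nbhsr|exact: lt_nbhsl].
by apply: filterS => s /andP[as_ sb] /=; rewrite clamp_id// !ltW.
Unshelve. all: by end_near. Qed.

Lemma derive1_clamp {V : normedModType R} (g : R -> V) a b t : a < t < b ->
  derive1 (g \o clamp a b) t = derive1 g t.
Proof. by move=> atb; rewrite !derive1E; apply/near_eq_derive/near_clamp. Qed.

End Clamp.

Section Speed.
Context {R : realType} {N : nat}.
Notation mu := (@lebesgue_measure R).
Implicit Types (g : R -> 'rV[R]_N) (a b : R).

Lemma measurable_speed g a b : a <= b -> {within `[a, b], continuous g} ->
  measurable_fun `]a, b[ (fun t => enorm (derive1 g t)).
Proof.
move=> ab cg.
apply: (eq_measurable_fun (fun t => enorm (derive1 (g \o clamp a b) t))).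
  by move=> t; rewrite inE/= in_itv/= => atb; rewrite derive1_clamp.
apply: measurable_funTS.
apply: (@measurable_fun_derive1 R _ (g \o clamp a b) _ (@enorm R N));
  last exact: continuous_enorm.
exact: continuous_clamp.
Qed.

Lemma is_derive_edot g (u : 'rV[R]_N) (dg : 'I_N -> R) (t : R) :
  (forall i, is_derive t 1 (fun s => g s ord0 i) (dg i)) ->
  is_derive t 1 (fun s => edot u (g s)) (\sum_(i < N) u ord0 i * dg i).
Proof.
move=> H.
have := is_derive_sum (fun i => is_deriveZ (u ord0 i) (H i)).
congr (is_derive _ _ _ _).
by apply/funext => s; rewrite fct_sumE.
Qed.

(** Project on the chord [u = g b - g a]: the real function
    [t |-> edot u (g t)] is Lipschitz, increases by [|u|^2] over the segment,
    and by Cauchy-Schwarz its derivative is at most [|u| |g'|] in size. *)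
Lemma ler_enorm_integral_speed g (K a b : R) : a <= b ->
  (forall s t, a <= s <= b -> a <= t <= b ->
    enorm (g s - g t) <= K * `|s - t|) ->
  ((enorm (g b - g a))%:E <=
   \int[mu]_(t in `[a, b]) (enorm (derive1 g t))%:E)%E.
Proof.
rewrite le_eqVlt => /orP[/eqP -> _|ab gK].
  by rewrite subrr enorm0 integral_ge0// => t _; rewrite lee_fin enorm_ge0.
have aab : a <= a <= b by rewrite lexx ltW.
have bab : a <= b <= b by rewrite lexx ltW.
have K0 : 0 <= K.
  have := gK b a bab aab; rewrite gtr0_norm ?subr_gt0// => H.
  rewrite -(pmulr_lge0 _ (_ : 0 < b - a)) ?subr_gt0//.
  by rewrite (le_trans _ H)// enorm_ge0.
pose h := g \o clamp a b.
have hK s t : enorm (h s - h t) <= K * `|s - t|.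
  apply: (le_trans (gK _ _ (clamp_itv s (ltW ab)) (clamp_itv t (ltW ab)))).
  by rewrite ler_wpM2l// clamp_lipschitz.
have hiK i s t : `|h s ord0 i - h t ord0 i| <= K * `|s - t|.
  apply: le_trans (hK s t).
  by have := coord_le_enorm (h s - h t) i; rewrite !mxE.
have ch : continuous h.
  apply: (@lipschitz_continuous _ _ _ K) => s t.
  exact: le_trans (mx_norm_le_enorm _) (hK s t).
set u := g b - g a.
have hb : h b = g b by rewrite /h/= clamp_id.
have ha : h a = g a by rewrite /h/= clamp_id.
have fK s t : `|edot u (h s) - edot u (h t)| <= enorm u * K * `|s - t|.
  have -> : edot u (h s) - edot u (h t) = edot u (h s - h t).
    by rewrite /edot -sumrB; apply: eq_bigr => i _; rewrite !mxE; ring.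
  rewrite -mulrA ler_norml; apply/andP; split.
    rewrite lerNl; have -> : - edot u (h s - h t) = edot u (h t - h s).
      by rewrite /edot -sumrN; apply: eq_bigr => i _; rewrite !mxE; ring.
    apply: (le_trans (edot_le _ _)); rewrite ler_wpM2l ?enorm_ge0//.
    by rewrite enormBC.
  by apply: (le_trans (edot_le _ _)); rewrite ler_wpM2l ?enorm_ge0.
have [u0|u0] := eqVneq (enorm u) 0.
  by rewrite u0 integral_ge0// => t _; rewrite lee_fin enorm_ge0.
have {}u0 : 0 < enorm u by rewrite lt_def u0 enorm_ge0.
have [phi [iphi phiE aephi]] := lipschitz_FTC ab fK.
have /choice[dh dhP] : forall i, exists p : R -> R,
    {ae mu, forall x, `]a, b[%classic x ->
      is_derive x 1 (fun s => h s ord0 i) (p x)}.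
  by move=> i; have [p [_ _ ?]] := lipschitz_FTC ab (hiK i); exists p.
have mspeed : measurable_fun `]a, b[ (fun t => enorm (derive1 g t)).
  apply: (eq_measurable_fun (fun t => enorm (derive1 h t))).
    by move=> t; rewrite inE/= in_itv/= => atb; rewrite derive1_clamp.
  apply: measurable_funTS.
  by apply: (@measurable_fun_derive1 R _ h ch (@enorm R N));
    exact: continuous_enorm.
rewrite integral_itv_bndoo; last exact/measurable_EFinP.
have mphi : measurable_fun `]a, b[ phi.
  have /measurable_EFinP := measurable_int _ iphi.
  by apply: measurable_funS => //; exact: subset_itv_oo_oc.
rewrite -(@lee_pmul2l _ (enorm u)%:E)//.
rewrite -EFinM -expr2 enorm_sqr.
have -> : edot u u = edot u (h b) - edot u (h a).
  rewrite hb ha /edot -sumrB; apply: eq_bigr => i _; rewrite /u !mxE; ring.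
rewrite phiE integral_itv_bndoo; last exact/measurable_EFinP.
rewrite -ge0_integralZl//; last 3 first.
- exact/measurable_EFinP.
- by move=> t _; rewrite lee_fin enorm_ge0.
- by rewrite lee_fin ltW.
apply: (le_trans (lee_abs _)).
apply: (le_trans (le_abse_integral _ _ _)) => //.
  exact/measurable_EFinP.
apply: ae_ge0_le_integral => //.
- by apply/measurable_EFinP; exact: measurableT_comp.
- by move=> t _; rewrite mule_ge0// lee_fin ?enorm_ge0// ltW.
- by apply/measurable_EFinP; exact: measurable_funM.
have aedh : {ae mu, forall x, forall i, `]a, b[%classic x ->
    is_derive x 1 (fun s => h s ord0 i) (dh i x)}.
  by apply: (@filter_forall _ _ _ _ (ae_filter_ringOfSetsType mu)).
apply: (@filterS2 _ _ (ae_filter_ringOfSetsType mu) _ _ _ _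
  aephi aedh) => x phix dhx abx.
have -> : phi x = edot u (derive1 g x).
  rewrite -(@derive1_clamp _ _ g a b); last by move: abx; rewrite /= in_itv.
  have dhx' i := dhx i abx.
  have dx : derivable h x 1.
    by apply/derivable_mxP => i j; rewrite ord1; exact: ex_derive.
  rewrite derive1E (derive_mx dx).
  have H1 := is_derive_edot u dhx'.
  have H2 := phix abx.
  rewrite -(@derive_val _ _ _ _ _ _ _ H2) (@derive_val _ _ _ _ _ _ _ H1).
  apply: eq_bigr => i _; congr (_ * _).
  by rewrite [RHS]mxE (@derive_val _ _ _ _ _ _ _ (dhx' i)).
rewrite -EFinM /= lee_fin ler_norml; apply/andP; split; last exact: edot_le.
rewrite lerNl -(enormN (derive1 g x)).
have -> : - edot u (derive1 g x) = edot u (- derive1 g x).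
  by rewrite /edot -sumrN; apply: eq_bigr => i _; rewrite !mxE; ring.
exact: edot_le.
Qed.

End Speed.

(** * First hitting times and locally Lipschitz curves *)

Section FirstHit.
Context {R : realType}.

(** The first time is the infimum of the closed level set [f = v]; a value above
    [v] at an earlier time would produce an earlier crossing. *)
Lemma first_hit (f : R -> R) (v : R) : continuous f -> f 0 <= v <= f 1 ->
  exists2 c, 0 <= c <= 1 & f c = v /\ forall u, 0 <= u <= c -> f u <= v.
Proof.
move=> cf /andP[f0 f1].
have ivt u : 0 <= u -> v <= f u -> exists2 c, 0 <= c <= u & f c = v.
  move=> u0 vu; have [||c] := @IVT _ f 0 u v u0.
  - exact: continuous_subspaceT.
  - by rewrite ge_min f0/= le_max vu orbT.
  - by rewrite in_itv/= => cu fc; exists c.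
pose E := [set c : R | 0 <= c <= 1 /\ f c = v].
have [c0 c01 fc0] := ivt _ ler01 f1.
have E0 : has_inf E by split; [exists c0|exists 0 => x [/andP[]]].
have lbE x : E x -> inf E <= x by apply: ge_inf; exact: E0.2.
have i0 : 0 <= inf E.
  by apply: lb_le_inf; [exists c0|move=> x [/andP[]]].
have i1 : inf E <= 1 by apply: (le_trans (lbE c0 _)) => //; case/andP: c01.
have fE : f (inf E) = v.
  apply/eqP/negPn/negP => fE.
  have fd : 0 < `|f (inf E) - v| by rewrite normr_gt0 subr_eq0.
  have /cvgrPdist_lt/(_ _ fd) := cf (inf E).
  move=> /nbhs_ballP[e /= e0 eP].
  have [x [x01 fx] xe] := inf_adherent e0 E0.
  have : `|f (inf E) - f x| < `|f (inf E) - v|.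
    apply: eP; rewrite /ball/= distrC ger0_norm ?subr_ge0 ?lbE//.
    by rewrite ltrBlDl.
  by rewrite fx ltxx.
exists (inf E); first by rewrite i0.
split => // u /andP[u0 uE].
rewrite leNgt; apply/negP => fu.
have [w /andP[w0 wu] fw] := ivt _ u0 (ltW fu).
have Ew : E w by split => //; rewrite w0 (le_trans wu)// (le_trans uE).
have uw : u = w.
  by apply/eqP; rewrite eq_le wu andbT (le_trans uE)// lbE.
by move: fu; rewrite uw fw ltxx.
Qed.

End FirstHit.

Section LocallyLipschitz.
Context {R : realType} {N : nat}.
Variable g : R -> 'rV[R]_N.

Let lip (K a b : R) := forall s t, a <= s <= b -> a <= t <= b ->
    enorm (g s - g t) <= K * `|s - t|.

Let lip_le K a b : (forall s t, a <= s -> s <= t -> t <= b ->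
    enorm (g s - g t) <= K * (t - s)) -> lip K a b.
Proof.
move=> H s t /andP[as_ sb] /andP[at_ tb].
have [st|/ltW ts] := leP s t.
  by rewrite distrC ger0_norm ?subr_ge0// H.
by rewrite enormBC ger0_norm ?subr_ge0// H.
Qed.

Let lip_glue K k a b c d : a <= c -> c <= b -> b <= d ->
  lip K a b -> lip k c d ->
  lip (Num.max K k) a d.
Proof.
move=> ac cb bd Kab kcd; apply: lip_le => s t as_ st td.
have mK x y : x <= y -> K * `|x - y| <= Num.max K k * (y - x).
  move=> xy; rewrite distrC ger0_norm ?subr_ge0//.
  by rewrite ler_wpM2r ?subr_ge0// le_max lexx.
have mk x y : x <= y -> k * `|x - y| <= Num.max K k * (y - x).
  move=> xy; rewrite distrC ger0_norm ?subr_ge0//.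
  by rewrite ler_wpM2r ?subr_ge0// le_max lexx orbT.
have [tb|bt] := leP t b.
  by apply: (le_trans (Kab _ _ _ _));
    [rewrite as_ (le_trans st)|rewrite (le_trans as_)|exact: mK].
have [cs|sc] := leP c s.
  by apply: (le_trans (kcd _ _ _ _));
    [rewrite cs (le_trans st)|rewrite (le_trans cs)|exact: mk].
have sb : s <= b by rewrite (le_trans (ltW sc)).
have ab : a <= b by rewrite (le_trans ac).
have -> : g s - g t = (g s - g b) + (g b - g t) by rewrite addrA subrK.
have -> : Num.max K k * (t - s) =
    Num.max K k * (b - s) + Num.max K k * (t - b) by ring.
apply: (le_trans (ler_enormD _ _)); apply: lerD.
  by apply: (le_trans (Kab _ _ _ _));
    [rewrite as_|rewrite lexx andbT|exact: mK].
by apply: (le_trans (kcd _ _ _ _));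
    [rewrite cb|rewrite (le_trans cb (ltW bt))
    |apply: mk; exact: ltW].
Qed.

(** The supremum of the times up to which [g] is Lipschitz is attained and
    cannot be less than [b], because Lipschitz bounds on two overlapping
    intervals glue into one with the larger constant. *)
Lemma locally_lipschitz_segment (A : set R) a b : a <= b ->
  locally_lipschitz_on A g -> `[a, b] `<=` A ->
  exists K, forall s t, a <= s <= b -> a <= t <= b ->
    enorm (g s - g t) <= K * `|s - t|.
Proof.
move=> ab lA abA.
pose S := [set s | a <= s <= b /\ exists K, lip K a s].
have Sa : S a.
  split; first by rewrite lexx.
  exists 0 => s t sa ta.
  have -> : s = a by apply/eqP; rewrite eq_le andbC.
  have -> : t = a by apply/eqP; rewrite eq_le andbC.
  by rewrite subrr enorm0 mul0r.
have supS : has_sup S by split; [exists a|exists b => x [/andP[]]].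
set c := sup S.
have ubS x : S x -> x <= c by apply: ub_le_sup; exact: supS.2.
have cab : a <= c <= b.
  by rewrite ubS// ge_sup//; [exists a|move=> x [/andP[]]].
have [k [U [/nbhs_ballP[e /= e0 eU] kU]]] : exists (k : R) (U : set R),
    nbhs c U /\
    forall s s', (A `&` U) s -> (A `&` U) s' ->
      enorm (g s - g s') <= k * `|s - s'|.
  by apply: lA; apply: abA; rewrite /= in_itv.
have [s [/andP[as_ sb] [K Ks]] cs] := sup_adherent e0 supS.
pose d := Num.min (c + e / 2) b.
have sc : s <= c by apply: ubS; split; [rewrite as_|exists K].
have cd : c <= d.
  by rewrite /d le_min lerDl divr_ge0 ?(ltW e0)//; case/andP: cab.
have db : d <= b by rewrite /d ge_min lexx orbT.
have de : d <= c + e / 2 by rewrite /d ge_min lexx.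
have kd : lip k s d.
  have inAU x : s <= x <= d -> (A `&` U) x.
    move=> /andP[sx xd]; split.
      by apply: abA; rewrite /= in_itv/= (le_trans as_)//= (le_trans xd).
    apply: eU; rewrite /ball/= ltr_norml; apply/andP; split.
      have : e / 2 < e by rewrite ltr_pdivrMr// ltr_pMr// ltr1n.
      by lra.
    by move: cs; rewrite -/c; lra.
  by move=> x y sx sy; apply: kU; exact: inAU.
have Sd : S d.
  split; first by rewrite db andbT (le_trans as_)// (le_trans sc).
  exists (Num.max K k); exact: (lip_glue as_ _ (le_trans sc cd) Ks kd).
have dE : d = b.
  have dc := ubS _ Sd.
  move: (dc); rewrite /d ge_min => /orP[|bc]; first lra.
  by apply/eqP; rewrite eq_le ge_min lexx orbT/= le_min lexx andbT; lra.
by move: Sd; rewrite dE => -[_].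
Qed.

End LocallyLipschitz.

(** * The energy density and a lower bound for the distance *)

Section EnergyDensity.
Context {R : realType} {N : nat}.
Variables (W : 'rV[R]_N -> R).
Hypothesis W_continuous : continuous W.
Notation mu := (@lebesgue_measure R).
Implicit Types (g : R -> 'rV[R]_N).

Definition energy_density g (t : R) : R :=
  Num.sqrt (W (g t)) * enorm (derive1 g t).

Lemma energy_density_ge0 g t : 0 <= energy_density g t.
Proof. by rewrite mulr_ge0 ?sqrtr_ge0 ?enorm_ge0. Qed.

Lemma continuous_sqrtW : continuous (fun x => Num.sqrt (W x)).
Proof.
by move=> x; apply: (@cvg_comp _ _ _ W Num.sqrt);
  [exact: W_continuous|exact: sqrt_continuous].
Qed.

(** Stated on the open interval because values of a curve outside the segment
    can spoil its derivative at the endpoints. *)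
Lemma measurable_energy_density g a b : a <= b ->
  {within `[a, b], continuous g} -> measurable_fun `]a, b[ (energy_density g).
Proof.
move=> ab cg; apply: measurable_funM; last exact: measurable_speed.
apply: (eq_measurable_fun (fun t => Num.sqrt (W ((g \o clamp a b) t)))).
  move=> t; rewrite inE/= in_itv/= => /andP[at_ tb].
  by rewrite clamp_id// !ltW.
apply: measurable_funTS; apply: continuous_measurable_fun.
move=> t; apply: (@cvg_comp _ _ _ (g \o clamp a b) (fun x => Num.sqrt (W x))).
  exact: (continuous_clamp ab cg).
exact: continuous_sqrtW.
Qed.

Lemma energyE g : {within `[(0 : R), 1], continuous g} ->
  energy W g = (\int[mu]_(t in `]0%R, 1%R[) (energy_density g t)%:E)%E.
Proof.
move=> cg; apply: integral_itv_bndoo.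
apply/measurable_EFinP; exact: (measurable_energy_density ler01 cg).
Qed.

(** Follow the curve only until it first reaches distance [|q - p|] from [p].
    Up to then it stays in the ball where [sqrt W] is at least [c], hence avoids
    the zeros of [W] and is Lipschitz, and its Euclidean length is at least the
    distance travelled. *)
Lemma energy_ge_dist g (p q : 'rV[R]_N) (c : R) : 0 < c ->
  (forall x, enorm (x - p) <= enorm (q - p) -> c <= Num.sqrt (W x)) ->
  LipZ_from_to W p q g -> ((c * enorm (q - p))%:E <= energy W g)%E.
Proof.
move=> c0 cW [[cg lg] g0 g1].
pose h := g \o clamp 0 1.
have ch : continuous h by exact: continuous_clamp.
pose f t := enorm (h t - p).
have cf : continuous f.
  move=> t; apply: (@cvg_comp _ _ _ (fun t => h t - p) (@enorm R N)).
    by apply: cvgB; [exact: ch|exact: cvg_cst].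
  exact: continuous_enorm.
have h01 t : 0 <= t <= 1 -> h t = g t by move=> t01; rewrite /h/= clamp_id.
have f0 : f 0 = 0 by rewrite /f h01 ?lexx ?ler01// g0 subrr enorm0.
have f1 : f 1 = enorm (q - p) by rewrite /f h01 ?lexx ?ler01// g1.
have [|s s01 [fs fu]] := @first_hit _ f (enorm (q - p)) cf.
  by rewrite f0 f1 lexx enorm_ge0.
have [s0 s1] := andP s01.
have u01 u : 0 <= u <= s -> 0 <= u <= 1.
  by move=> /andP[-> us]; rewrite (le_trans us).
have cu u : 0 <= u <= s -> c <= Num.sqrt (W (g u)).
  by move=> us; apply: cW; rewrite -(h01 u (u01 _ us)); exact: fu.
have [K lK] : exists K, forall s' t, 0 <= s' <= s -> 0 <= t <= s ->
    enorm (g s' - g t) <= K * `|s' - t|.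
  apply: (locally_lipschitz_segment s0 lg) => u /=; rewrite in_itv/= => us.
  split; first by rewrite /= in_itv/= u01.
  move=> [_ /= Wu]; have := cu _ us.
  by rewrite Wu sqrtr0 leNgt c0.
have := ler_enorm_integral_speed s0 lK.
rewrite g0 -(h01 s s01) -/(f s) fs => H.
have cgs : {within `[0, s], continuous g}.
  apply: continuous_subspaceW cg => u /=; rewrite !in_itv/=; exact: u01.
have msp := measurable_speed s0 cgs.
rewrite EFinM; apply: (@le_trans _ _
    (c%:E * \int[mu]_(t in `]0%R, s[) (enorm (derive1 g t))%:E)%E).
  rewrite lee_pmul2l//.
  by rewrite integral_itv_bndoo in H; [|exact/measurable_EFinP].
rewrite -ge0_integralZl//; last 3 first.
- exact/measurable_EFinP.
- by move=> t _; rewrite lee_fin enorm_ge0.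
- by rewrite lee_fin ltW.
rewrite energyE//.
apply: (@le_trans _ _ (\int[mu]_(t in `]0%R, s[) (energy_density g t)%:E)%E).
  apply: ge0_le_integral => //.
  - by move=> t _; rewrite mule_ge0// lee_fin ?enorm_ge0// ltW.
  - by apply/measurable_EFinP; exact: measurable_funM.
  - apply/measurable_EFinP; exact: (measurable_energy_density s0 cgs).
  - move=> t /=; rewrite in_itv/= => /andP[t0 ts].
    by rewrite -EFinM lee_fin ler_wpM2r ?enorm_ge0// cu// !ltW.
apply: ge0_subset_integral => //.
- apply/measurable_EFinP; exact: (measurable_energy_density ler01 cg).
- by move=> t _; rewrite lee_fin energy_density_ge0.
- by move=> t /=; rewrite !in_itv/= => /andP[-> ts]; exact: lt_le_trans s1.
Qed.

Lemma dist_ge (p q : 'rV[R]_N) (c : R) : 0 < c ->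
  (forall x, enorm (x - p) <= enorm (q - p) -> c <= Num.sqrt (W x)) ->
  ((c * enorm (q - p))%:E <= dist_W W p q)%E.
Proof.
move=> c0 cW; apply: le_ereal_inf_tmp => _ [g pqg <-].
exact: energy_ge_dist cW pqg.
Qed.

Lemma dist_ge0 (p q : 'rV[R]_N) : (0 <= dist_W W p q)%E.
Proof.
apply: le_ereal_inf_tmp => _ [g _ <-].
by apply: integral_ge0 => t _; rewrite lee_fin energy_density_ge0.
Qed.

End EnergyDensity.

(** * Affine reparametrization *)

Section AffineChange.
Context {R : realType}.
Notation mu := (@lebesgue_measure R).

Let aff (a d s : R) : R := a + s * d.

Lemma continuous_affine (a d : R) : continuous (fun s : R => a + s * d).
Proof.
move=> s; apply: cvgD; first exact: cvg_cst.
by apply: cvgM; [exact: cvg_id|exact: cvg_cst].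
Qed.

Let measurable_affine (a d : R) :
  measurable_fun setT (aff a d : measurableTypeR R -> measurableTypeR R).
Proof. by apply: continuous_measurable_fun; exact: continuous_affine. Qed.

Let pushforward_affine (a d : R) :
    {measure set (measurableTypeR R) -> \bar R} :=
  measure_function_pushforward__canonical__measure_function_Measure
    mu (measurable_affine a d).

Let pushforward_affineE (a d : R) (d0 : 0 < d) (A : set (measurableTypeR R)) :
  measurable A -> mu A = mscale (NngNum (ltW d0)) (pushforward_affine a d) A.
Proof.
move=> mA; apply: lebesgue_measure_unique => // X [[x y] _ <-] /=.
rewrite [RHS](_ : _ = d%:E * mu (aff a d @^-1` `]x, y]%classic))%E//.
have -> : aff a d @^-1` `]x, y]%classic = `](x - a) / d, (y - a) / d]%classic.
  apply/seteqP; split => s /=; rewrite !in_itv/= /aff;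
    rewrite ltr_pdivrMr// ler_pdivlMr// ltrBlDl lerBrDl//.
rewrite !lebesgue_measure_itv/= !lte_fin ltr_pM2r ?invr_gt0// ltrBlDr subrK.
case: ifPn => xy; last by rewrite mule0.
by rewrite -!EFinB -EFinM; congr EFin; field; rewrite gt_eqF.
Qed.

Lemma ge0_integral_affine (f : R -> \bar R) (a d : R) : 0 < d ->
  measurable_fun `]a, (a + d)[ f -> (forall t, (0 <= f t)%E) ->
  (\int[mu]_(t in `]a, (a + d)%R[) f t =
   d%:E * \int[mu]_(s in `]0%R, 1%R[) f (a + s * d)%R)%E.
Proof.
move=> d0 mf f0.
transitivity (\int[mscale (NngNum (ltW d0)) (pushforward_affine a d)]_(t in
    `]a, (a + d)%R[) f t)%E.
  by apply: eq_measure_integral => A mA _; exact: pushforward_affineE.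
rewrite ge0_integral_mscale//=.
congr (_ * _)%E.
rewrite ge0_integral_pushforward//.
suff -> : aff a d @^-1` `]a, (a + d)[%classic = `]0, 1[%classic by [].
apply/seteqP; split => s /=; rewrite !in_itv/= /aff => /andP[s0 s1];
  apply/andP; split.
- by move: s0; rewrite ltrDl pmulr_lgt0.
- by move: s1; rewrite ltrD2l -[ltRHS]mul1r ltr_pM2r.
- by rewrite ltrDl pmulr_lgt0.
- by rewrite ltrD2l -[ltRHS]mul1r ltr_pM2r.
Qed.

Lemma is_derive_affine {V : normedModType R} (g : R -> V) (a d s : R) (v : V) :
  d != 0 -> is_derive (a + s * d) 1 g v ->
  is_derive s 1 (fun s : R => g (a + s * d)) (d *: v).
Proof.
move=> d0 [dg gv].
have cvgg : h^-1 *: (g (h + (a + s * d)) - g (a + s * d)) @[h --> 0^'] --> v.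
  move: dg; rewrite /derivable -gv /derive.
  by under eq_fun do rewrite /= [_ *: 1]mulr1.
have H : h^-1 *: (g (a + (h + s) * d) - g (a + s * d)) @[h --> 0^'] --> d *: v.
  have -> : (fun h => h^-1 *: (g (a + (h + s) * d) - g (a + s * d))) =
     (fun h => d *: ((h * d)^-1 *: (g (h * d + (a + s * d)) - g (a + s * d)))).
    apply/funext => h; rewrite scalerA invfM mulrCA mulfV// mulr1.
    by congr (_ *: (g _ - _)); ring.
  apply: cvgZ; first exact: cvg_cst.
  apply: (@cvg_comp _ _ _ (fun h => h * d) 
    (fun h => h^-1 *: (g (h + (a + s * d)) - g (a + s * d))) _ (0^'));
    last exact: cvgg.
  move=> A [e /= e0 eA].
  exists (e / `|d|) => /=; first by rewrite divr_gt0// normr_gt0.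
  move=> h /=; rewrite sub0r normrN => he h0.
  apply: eA => /=; last by rewrite mulf_neq0.
  by rewrite sub0r normrN normrM -ltr_pdivlMr ?normr_gt0.
split.
  apply/cvg_ex; exists (d *: v); move: H.
  by under [X in _ -> X @ _ --> _]eq_fun do rewrite /= [_ *: 1]mulr1.
apply/cvg_lim => //; move: H.
by under [X in _ -> X @ _ --> _]eq_fun do rewrite /= [_ *: 1]mulr1.
Qed.

(** A limit that does not exist is by default the point of the target type,
    which for matrices is the zero matrix. *)
Lemma derive1_default {N : nat} (g : R -> 'rV[R]_N) (t : R) :
  ~ derivable g t 1 -> derive1 g t = 0.
Proof.
move=> nd; rewrite derive1E /derive (dvgP nd).
by apply/matrixP => i j; rewrite !mxE.
Qed.

(** Holds at every time: where the derivative does not exist on one side, it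
    does not on the other, and the default value [0] is fixed by scaling. *)
Lemma derive1_affine {N : nat} (g : R -> 'rV[R]_N) (a d s : R) : d != 0 ->
  derive1 (fun s : R => g (a + s * d)) s = d *: derive1 g (a + s * d).
Proof.
move=> d0.
have [dg|dg] := pselect (derivable g (a + s * d) 1).
  rewrite !derive1E; apply: derive_val.
  by apply: is_derive_affine => //; exact: derivableP.
have dga : ~ derivable (fun s : R => g (a + s * d)) s 1.
  move=> dga; apply: dg.
  have sE : s = - a / d + (a + s * d) * d^-1 by field.
  rewrite sE in dga.
  have := @is_derive_affine _ (fun s : R => g (a + s * d)) 
    (- a / d) d^-1 (a + s * d) _ (invr_neq0 d0) (derivableP dga).
  have -> : (fun t => g (a + (- a / d + t * d^-1) * d)) = g.
    by apply/funext => t; congr g; field.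
  by case.
by rewrite (derive1_default dg) (derive1_default dga) scaler0.
Qed.

End AffineChange.

(** * Length is at most energy *)

Section LengthLeEnergy.
Context {R : realType} {N : nat}.
Variables (W : 'rV[R]_N -> R).
Hypothesis W_continuous : continuous W.
Notation mu := (@lebesgue_measure R).
Variable g : R -> 'rV[R]_N.
Hypothesis gL : LipZ W g.

Let cg : {within `[(0 : R), 1], continuous g} := gL.1.

Lemma LipZ_affine a b : 0 <= a -> a < b -> b <= 1 ->
  LipZ W (fun s => g (a + s * (b - a))).
Proof.
move=> a0 ab b1; set d := b - a.
have d0 : 0 < d by rewrite subr_gt0.
have H s : `[0, 1]%classic s -> `[0, 1]%classic (a + s * d).
  rewrite /= !in_itv/= => /andP[s0 s1]; rewrite addr_ge0 ?mulr_ge0 ?(ltW d0)//=.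
  rewrite (le_trans _ b1)// -[leRHS](subrKC a) lerD2l -/d.
  by rewrite -[leRHS]mul1r ler_wpM2r// ltW.
split.
  apply/subspace_continuousP => s s01.
  have ctw : a + s' * d @[s' --> within `[0, 1] (nbhs s)] -->
      within `[0, 1] (nbhs (a + s * d)).
    move=> A /= wA.
    have K : \forall s' \near s, `[0, 1]%classic (a + s' * d) -> A (a + s' * d).
      exact: (@continuous_affine R a d s _ wA).
    by apply: filterS K => s' K /H; exact: K.
  apply: (cvg_comp _ _ ctw).
  by move/subspace_continuousP : cg; apply; exact: H.
move=> s [s01 sZ].
have [|k [U [nU kU]]] := gL.2 (a + s * d).
  by split; [exact: H|move=> [_ Wz]; apply: sZ; split].
exists (k * d), ((fun s' => a + s' * d) @^-1` U); split.
  exact: (@continuous_affine R a d s _ nU).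
move=> x y [[x01 xZ] xU] [[y01 yZ] yU].
have -> : k * d * `|x - y| = k * `|(a + x * d) - (a + y * d)|.
  rewrite opprD addrACA subrr add0r -mulrBl normrM (gtr0_norm d0); ring.
apply: kU; split => //; split; try exact: H.
  by move=> [_ Wz]; apply: xZ; split.
by move=> [_ Wz]; apply: yZ; split.
Qed.

Lemma dist_le_integral a b : 0 <= a -> a < b -> b <= 1 ->
  (dist_W W (g a) (g b) <= \int[mu]_(t in `]a, b[) (energy_density W g t)%:E)%E.
Proof.
move=> a0 ab b1; set d := b - a.
have d0 : 0 < d by rewrite subr_gt0.
pose h (s : R) := g (a + s * d).
have hL : LipZ W h by exact: LipZ_affine.
have -> : (\int[mu]_(t in `]a, b[) (energy_density W g t)%:E)%E = energy W h.
  rewrite (energyE W_continuous hL.1).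
  have bE : b = a + d by rewrite /d addrC subrK.
  rewrite [X in `]_, X[]bE ge0_integral_affine//; last 2 first.
  - rewrite -bE.
    have cgab : {within `[a, b], continuous g}.
      apply: continuous_subspaceW cg => t /=.
      rewrite !in_itv/= => /andP[at_ tb].
      by rewrite (le_trans a0)//= (le_trans tb).
    apply/measurable_EFinP.
    exact: (measurable_energy_density W_continuous (ltW ab) cgab).
  - by move=> t; rewrite lee_fin energy_density_ge0.
  rewrite -ge0_integralZl//; last 3 first.
  - apply/measurable_EFinP.
    apply: (eq_measurable_fun (fun s => d^-1 * energy_density W h s)).
      move=> s _; rewrite /energy_density /h derive1_affine ?gt_eqF// enormZ.
      by rewrite (gtr0_norm d0) mulrCA mulKf// gt_eqF.
    apply: measurable_funM; first exact: measurable_cst.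
    exact: (measurable_energy_density W_continuous ler01 hL.1).
  - by move=> t _; rewrite lee_fin energy_density_ge0.
  - by rewrite lee_fin ltW.
  apply: eq_integral => s _; rewrite -EFinM; congr EFin.
  rewrite /energy_density /h derive1_affine ?gt_eqF// enormZ (gtr0_norm d0).
  by rewrite mulrCA.
apply: ereal_inf_lbound; exists h => //; split => //.
  by rewrite /h mul0r addr0.
by rewrite /h mul1r /d addrC subrK.
Qed.

(** Restricting the curve to each interval of the partition gives a competitor
    for the corresponding distance, and the energies of the pieces add up. *)
Lemma sum_dist_le_integral (s : seq R) a b : 0 <= a -> b <= 1 ->
  itv_partition a b s ->
  (\sum_(0 <= j < size s) dist_W W (g (nth 1%R (a :: s) j))
     (g (nth 1%R (a :: s) j.+1)) <=
   \int[mu]_(t in `]a, b[) (energy_density W g t)%:E)%E.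
Proof.
elim: s a => [|x s IH] a a0 b1 ps.
  rewrite big_geq//; apply: integral_ge0 => t _.
  by rewrite lee_fin energy_density_ge0.
have xb := itv_partition_cons ps.
have xleb := itv_partition_le xb.
have ax : a < x by case: ps => /= /andP[].
rewrite big_nat_recl//=.
have x0 : 0 <= x by rewrite (le_trans a0)// ltW.
apply: (le_trans (leeD (dist_le_integral a0 ax (le_trans xleb b1))
                       (IH x x0 b1 xb))).
have mab : measurable_fun `]a, b[ (EFin \o energy_density W g).
  apply/measurable_EFinP.
  apply: (measurable_funS _ _
    (measurable_energy_density W_continuous ler01 cg)) => //.
  move=> t /=; rewrite !in_itv/= => /andP[at_ tb].
  by rewrite (le_lt_trans a0)//= (lt_le_trans tb).
have sub : `]a, x[ `|` `]x, b[ `<=` `]a, b[.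
  move=> t [] /=; rewrite !in_itv/= => /andP[t1 t2].
    by rewrite t1/= (lt_le_trans t2).
  by rewrite t2 andbT (lt_trans ax).
rewrite -ge0_integral_setU//.
- apply: ge0_subset_integral => //.
    exact: measurableU.
  by move=> t _; rewrite lee_fin energy_density_ge0.
- exact: measurable_funS mab.
- by move=> t _; rewrite lee_fin energy_density_ge0.
- apply/disj_setPS => t [/=]; rewrite !in_itv/= => /andP[_ tx] /andP[xt _].
  by move: (lt_trans tx xt); rewrite ltxx.
Qed.

Lemma curve_length_le_energy : (curve_length W g <= energy W g)%E.
Proof.
apply: ge_ereal_sup => _ [s ps <-].
rewrite (energyE W_continuous cg).
exact: sum_dist_le_integral.
Qed.

End LengthLeEnergy.

(** * The distance between nearby points of a curve *)

Section LowerLimit.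
Context {R : realType}.
Local Open Scope ereal_scope.

Lemma limn_einf_le (u : (\bar R)^nat) (L : \bar R) :
  (forall n, u n <= L) -> limn_einf u <= L.
Proof.
move=> uL; rewrite limn_einf_lim; apply: lime_le; first exact: is_cvg_einfs.
near=> n; apply: le_trans (uL n); apply: ereal_inf_lbound.
by exists n => //=.
Unshelve. all: by end_near. Qed.

Lemma limn_einf_ge (u : (\bar R)^nat) (L : \bar R) :
  (\forall n \near \oo, L <= u n) -> L <= limn_einf u.
Proof.
move=> [m _ mL]; rewrite limn_einf_lim; apply: lime_ge;
  first exact: is_cvg_einfs.
exists m => // n /= mn; apply: le_ereal_inf_tmp => _ [k /= nk <-].
by apply: mL; exact: leq_trans nk.
Qed.

Lemma measurable_fun_limn_einf (D : set R) (f : (R -> \bar R)^nat) :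
  (forall n, measurable_fun D (f n)) ->
  measurable_fun D (fun x => limn_einf (f ^~ x)).
Proof.
move=> mf; apply: (@emeasurable_fun_cvg _ _ _ _ (fun n x => einfs (f ^~ x) n)).
  exact: measurable_fun_einfs.
by move=> x _; rewrite limn_einf_lim; exact: is_cvg_einfs.
Qed.

End LowerLimit.

Section EnergyLeLength.
Context {R : realType} {N : nat}.
Variables (W : 'rV[R]_N -> R).
Hypothesis W_continuous : continuous W.
Notation mu := (@lebesgue_measure R).
Implicit Type g : R -> 'rV[R]_N.

Lemma derivable_first_order g (t e : R) : derivable g t 1 -> 0 < e ->
  exists2 d, 0 < d & forall s, `|s - t| < d ->
    enorm (g s - g t - (s - t) *: derive1 g t) <= e * `|s - t|.
Proof.
move=> dg e0; set v : 'rV[R]_N := derive1 g t.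
have cv : h^-1 *: (g (h + t) - g t) @[h --> 0^'] --> v.
  move: dg; rewrite /derivable /v derive1E /derive.
  by under eq_fun do rewrite /= [_ *: 1]mulr1.
have eN : 0 < e / N.+1%:R by rewrite divr_gt0.
have [d /= d0 dP] : \forall h \near 0^',
    `|v - h^-1 *: (g (h + t) - g t)| < e / N.+1%:R.
  have nv : \forall y \near v, `|v - y| < e / N.+1%:R.
    by apply/nbhs_normP; exists (e / N.+1%:R).
  exact: (cv _ nv).
exists d => // s sd.
have [->|st] := eqVneq s t.
  by rewrite !subrr scale0r subr0 enorm0 normr0 mulr0.
have st0 : s - t != 0 by rewrite subr_eq0.
have /= := dP (s - t); rewrite sub0r normrN subrK => /(_ sd st0) H.
have -> : g s - g t - (s - t) *: v =
    (s - t) *: - (v - (s - t)^-1 *: (g s - g t)).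
  by rewrite opprB scalerBr scalerA mulfV// scale1r.
rewrite enormZ enormN mulrC ler_wpM2r//.
apply: (le_trans (enorm_le_mx_norm _)).
apply: (@le_trans _ _ (N.+1%:R * (e / N.+1%:R))).
  by apply: ler_pM => //; [rewrite ler_nat|exact: ltW].
by rewrite mulrC divfK// pnatr_eq0.
Qed.

(** A continuity radius for [sqrt W] and the first-order expansion together
    give the lower bound. Because [a] and [b] lie on either side of [t], the two
    first-order errors [e (t - a)] and [e (b - t)] add up to [e (b - a)]. *)
Lemma dist_ge_speed g (t e : R) : derivable g t 1 ->
  0 < e < Num.sqrt (W (g t)) ->
  exists2 d, 0 < d & forall a b, a <= t <= b -> b - a < d ->
   (((Num.sqrt (W (g t)) - e) * ((enorm (derive1 g t) - e) * (b - a)))%:E <=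
     dist_W W (g a) (g b))%E.
Proof.
move=> dg /andP[e0 eS]; set v : 'rV[R]_N := derive1 g t.
set S := Num.sqrt (W (g t)).
have [r r0 rP] : exists2 r, 0 < r &
    forall x, enorm (x - g t) < r -> S - e <= Num.sqrt (W x).
  have := @continuous_sqrtW _ _ _ W_continuous (g t).
  have nS : \forall y \near S, `|S - y| < e by apply/nbhs_normP; exists e.
  move=> /(_ _ nS) /nbhs_normP[r /= r0 rP].
  exists r => // x xr; have /= := rP x.
  rewrite -opprB normrN (le_lt_trans (mx_norm_le_enorm _) xr) => /(_ isT).
  by rewrite ltr_norml => /andP[_]; lra.
have [d d0 dP] := derivable_first_order dg e0.
have ve0 : 0 < enorm v + e by rewrite ltr_wpDl ?enorm_ge0.
(* Within [d'] of [t] the curve moves by less than [r / 3], so that the ball of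
   centre [g a] and radius [|g b - g a|] lies in the [r]-ball around [g t]. *)
pose d' := Num.min d (r / (3 * (enorm v + e))).
have d'0 : 0 < d'.
  by rewrite /d' lt_min d0 divr_gt0// mulr_gt0.
have near_t s : `|s - t| < d' -> enorm (g s - g t) < r / 3.
  rewrite lt_min => /andP[sd sr].
  have -> : g s - g t =
      (g s - g t - (s - t) *: v) + (s - t) *: v by rewrite subrK.
  apply: (le_lt_trans (ler_enormD _ _)); rewrite enormZ.
  apply: (@le_lt_trans _ _ ((enorm v + e) * `|s - t|)).
    by have := dP _ sd; rewrite -/v; lra.
  apply: (@lt_le_trans _ _ ((enorm v + e) * (r / (3 * (enorm v + e))))).
    by rewrite ltr_pM2l.
  by rewrite le_eqVlt; apply/orP; left; apply/eqP; field; rewrite gt_eqF.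
exists d' => // a b /andP[at_ tb] bad.
have ad' : `|a - t| < d'.
  by rewrite distrC ger0_norm ?subr_ge0//; lra.
have bd' : `|b - t| < d'.
  by rewrite ger0_norm ?subr_ge0//; lra.
have ga := near_t _ ad'; have gb := near_t _ bd'.
have pq : enorm (g b - g a) < 2 * (r / 3).
  have -> : g b - g a = (g b - g t) + (g t - g a) by rewrite addrA subrK.
  apply: (le_lt_trans (ler_enormD _ _)); rewrite (enormBC (g t)); lra.
have : (((S - e) * enorm (g b - g a))%:E <= dist_W W (g a) (g b))%E.
  apply: dist_ge => //; first by rewrite subr_gt0.
  move=> x xab; apply: rP.
  have -> : x - g t = (x - g a) + (g a - g t) by rewrite addrA subrK.
  apply: (le_lt_trans (ler_enormD _ _)); lra.
move=> H; apply: le_trans H; rewrite lee_fin.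
apply: ler_wpM2l; first by rewrite subr_ge0 ltW.
have [ad bd] : `|a - t| < d /\ `|b - t| < d.
  by move: ad' bd'; rewrite !lt_min => /andP[-> _] /andP[-> _].
have Ea := dP _ ad; have Eb := dP _ bd; rewrite -/v in Ea Eb.
rewrite distrC ger0_norm ?subr_ge0// in Ea.
rewrite ger0_norm ?subr_ge0// in Eb.
have -> : g b - g a =
    (b - a) *: v - ((g a - g t - (a - t) *: v) - (g b - g t - (b - t) *: v)).
  by apply/rowP => i; rewrite !mxE; ring.
apply: le_trans (ler_enormB _ _).
rewrite enormZ ger0_norm ?subr_ge0 ?(le_trans at_)//.
have : enorm (g a - g t - (a - t) *: v - (g b - g t - (b - t) *: v))
    <= e * (b - a).
  apply: (le_trans (ler_enormD _ _)); rewrite enormN.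
  lra.
lra.
Qed.

End EnergyLeLength.

(** * Energy is at most length *)

Section Fatou.
Context {R : realType} {N : nat}.
Variables (W : 'rV[R]_N -> R).
Hypothesis W_continuous : continuous W.
Notation mu := (@lebesgue_measure R).
Variable g : R -> 'rV[R]_N.
Hypothesis gL : LipZ W g.

Let node n j : R := j%:R / n.+1%:R.

Let nodeB n j : node n j.+1 - node n j = n.+1%:R^-1.
Proof. by rewrite /node -mulrBl -natrB// subSnn mul1r. Qed.

Let node_lt n j : node n j < node n j.+1.
Proof. by rewrite -subr_gt0 nodeB invr_gt0. Qed.

Definition uniform_partition n : seq R := mkseq (fun j => node n j.+1) n.+1.

Let nth_partition n j : (j <= n.+1)%N ->
  nth 1 (0 :: uniform_partition n) j = node n j.
Proof.
case: j => [_|j jn] /=; first by rewrite /node mul0r.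
by rewrite nth_mkseq.
Qed.

Lemma itv_partition_uniform n : itv_partition 0 1 (uniform_partition n).
Proof.
split.
  apply/(pathP 1) => j; rewrite size_mkseq => jn.
  rewrite nth_partition ?(ltnW jn)//.
  by rewrite nth_mkseq// node_lt.
apply/eqP; rewrite (last_nth 1) size_mkseq nth_partition// /node.
by rewrite divff// pnatr_eq0.
Qed.

Let cell n j : set R := `[node n j, node n j.+1[%classic.

Let measurable_cell n j : measurable (cell n j : set (measurableTypeR R)).
Proof. exact: measurable_itv. Qed.

Let rate n j : \bar R :=
  (n.+1%:R%:E * dist_W W (g (node n j)) (g (node n j.+1)))%E.

Let rate_ge0 n j : (0 <= rate n j)%E.
Proof. by rewrite mule_ge0// ?lee_fin// dist_ge0. Qed.

(** Its value on each cell is the average speed of [g] for the metric [d], so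
    that its integral is the polygonal sum along the uniform partition. *)
Definition step_speed n (t : R) : \bar R :=
  (\sum_(0 <= j < n.+1) rate n j * (\1_(cell n j) t)%:E)%E.

Let term_ge0 n j t : (0 <= rate n j * (\1_(cell n j) t)%:E)%E.
Proof. by rewrite mule_ge0// lee_fin. Qed.

Lemma step_speed_ge0 n t : (0 <= step_speed n t)%E.
Proof. by apply: sume_ge0 => j _; exact: term_ge0. Qed.

Let measurable_term n j (D : set R) :
  measurable_fun D (fun t => rate n j * (\1_(cell n j) t)%:E)%E.
Proof.
apply: emeasurable_funM; first exact: measurable_cst.
apply/measurable_EFinP; exact: (measurable_indic (measurable_cell n j)).
Qed.

Lemma measurable_step_speed n (D : set R) : measurable_fun D (step_speed n).
Proof. by apply: emeasurable_sum => j; exact: measurable_term. Qed.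

Lemma integral_step_speed_le n :
  (\int[mu]_(t in `]0%R, 1%R[) step_speed n t <= curve_length W g)%E.
Proof.
rewrite ge0_integral_sum//; last first.
  by move=> j; exact: measurable_term.
apply: (@le_trans _ _ (\sum_(0 <= j < n.+1)
    dist_W W (g (node n j)) (g (node n j.+1)))%E).
  apply: lee_sum => j _.
  rewrite ge0_integralZl//; last first.
    apply/measurable_EFinP; exact: (measurable_indic (measurable_cell n j)).
  rewrite integral_indic//.
  have mc : mu (cell n j) = (n.+1%:R^-1)%:E.
    by rewrite /cell lebesgue_measure_itv/= lte_fin node_lt -EFinB nodeB.
  apply: (@le_trans _ _ (rate n j * (n.+1%:R^-1)%:E)%E).
    apply: lee_wpmul2l => //; rewrite -mc; apply: le_measure; rewrite ?inE//.
    by apply: measurableI; [exact: measurable_cell|exact: measurable_itv].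
  by rewrite /rate muleAC -EFinM mulfV ?pnatr_eq0// mul1e.
apply: ereal_sup_ubound; exists (uniform_partition n).
  exact: itv_partition_uniform.
rewrite size_mkseq; apply: eq_big_nat => j /andP[_ jn].
by rewrite !nth_partition// ltnW.
Qed.

Lemma step_speed_ge (n : nat) (t : R) : 0 < t < 1 -> exists a b,
  [/\ a <= t <= b, b - a = n.+1%:R^-1 &
    (n.+1%:R%:E * dist_W W (g a) (g b) <= step_speed n t)%E].
Proof.
move=> /andP[t0 t1].
have tn0 : 0 <= t * n.+1%:R by rewrite mulr_ge0// ltW.
have := truncn_itv tn0; set j := Num.trunc _ => /andP[jt tj].
have jn : (j < n.+1)%N.
  by rewrite -(ltr_nat R) (le_lt_trans jt)// -[ltRHS]mul1r ltr_pM2r.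
have nt : node n j <= t by rewrite /node ler_pdivrMr.
have tn : t < node n j.+1 by rewrite /node ltr_pdivlMr.
exists (node n j), (node n j.+1); split; [by rewrite nt ltW|exact: nodeB|].
rewrite /step_speed big_mkord (bigD1 (Ordinal jn))//=.
rewrite -[X in (X <= _)%E]adde0; apply: leeD.
  rewrite indicE mem_set ?mule1//.
  by rewrite /cell/= in_itv/= nt tn.
by apply: sume_ge0 => i _; exact: term_ge0.
Qed.

(** Where [g] is not derivable, or [W] vanishes, the density is [0]. Elsewhere
    the cell containing [t] shrinks to [t] and [dist_ge_speed] applies to it
    with arbitrarily small loss. *)
Lemma energy_density_le_liminf (t : R) : 0 < t < 1 ->
  ((energy_density W g t)%:E <= limn_einf (step_speed ^~ t))%E.
Proof.
move=> t01.
have ge0 : (0 <= limn_einf (step_speed ^~ t))%E.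
  by apply: limn_einf_ge; apply: nearW => n; exact: step_speed_ge0.
have [dg|dg] := pselect (derivable g t 1); last first.
  by rewrite /energy_density derive1_default// enorm0 mulr0.
have [S0|S0] := eqVneq (Num.sqrt (W (g t))) 0.
  by rewrite /energy_density S0 mul0r.
rewrite /energy_density; set S := Num.sqrt _; set v := enorm _.
have {}S0 : 0 < S by rewrite lt_def S0 sqrtr_ge0.
have v0 : 0 <= v by exact: enorm_ge0.
apply/lee_addgt0Pr => eps eps0.
have Sv0 : 0 < S + v by rewrite ltr_wpDr.
(* [(S - e) (v - e) = S v - e (S + v) + e^2]. *)
pose e := Num.min (S / 2) (eps / (S + v)).
have e0 : 0 < e by rewrite /e lt_min divr_gt0//= divr_gt0.
have eS : e < S.
  rewrite /e gt_min; apply/orP; left.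
  by rewrite ltr_pdivrMr// ltr_pMr// ltr1n.
have eeps : e * (S + v) <= eps by rewrite -ler_pdivlMr// /e ge_min lexx orbT.
have [|d d0 dP] := @dist_ge_speed _ _ _ W_continuous g t e dg.
  by rewrite e0.
suff H : (((S - e) * (v - e))%:E <= limn_einf (step_speed ^~ t))%E.
  apply: (@le_trans _ _ (((S - e) * (v - e))%:E + eps%:E)%E).
    rewrite -EFinD lee_fin; have : 0 <= e * e by rewrite mulr_ge0// ltW.
    by move: eeps; clearbody e; lra.
  by rewrite leeD2r.
apply: limn_einf_ge.
have : \forall n \near \oo, n.+1%:R^-1 < d :> R.
  exact: near_infty_natSinv_lt (PosNum d0).
apply: filterS => n nd.
have [a [b [atb ba step]]] := step_speed_ge n t01.
apply: le_trans step.
have := dP a b atb; rewrite ba => /(_ nd) H.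
rewrite -[leLHS](_ :
  (n.+1%:R%:E * ((S - e) * ((v - e) * n.+1%:R^-1))%:E)%E = _); last first.
  rewrite -EFinM; congr EFin; rewrite mulrCA (mulrCA _ (v - e)).
  by rewrite mulfV ?pnatr_eq0// mulr1.
by rewrite lee_pmul2l.
Qed.

Lemma energy_le_curve_length : (energy W g <= curve_length W g)%E.
Proof.
rewrite (energyE W_continuous gL.1).
apply: (@le_trans _ _ (\int[mu]_(t in `]0%R, 1%R[)
  limn_einf (step_speed ^~ t))%E).
  apply: ge0_le_integral => //.
  - by move=> t _; rewrite lee_fin energy_density_ge0.
  - apply/measurable_EFinP.
    exact: (measurable_energy_density W_continuous ler01 gL.1).
  - by apply: measurable_fun_limn_einf => n; exact: measurable_step_speed.
  - by move=> t /=; rewrite in_itv/=; exact: energy_density_le_liminf.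
apply: (le_trans (fatou _ _ _ _)) => //.
- by move=> n; exact: measurable_step_speed.
- by move=> n t _; exact: step_speed_ge0.
by apply: limn_einf_le => n; exact: integral_step_speed_le.
Qed.

End Fatou.

(** * Length equals energy *)

Unset Implicit Arguments.

Theorem theorem2p4 (R : realType) (N m : nat) (hN : (2 <= N)%N)
  (hm : (2 <= m)%N)
  (W : 'rV[R]_N -> R) (W_continuous : continuous W)
  (W_ge0 : forall x : 'rV[R]_N, 0 <= W x)
  (p : 'I_m -> 'rV[R]_N) (p_distinct : injective p)
  (W_zeros : zeros W = range p)
  (W_liminf : (0 < limf_einf (EFin \o W) (@at_infinity R N))%E)
  (gamma : R -> 'rV[R]_N) (gamma_Lip : LipZ W gamma) :
  curve_length W gamma = energy W gamma.
Proof.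
apply/eqP; rewrite eq_le curve_length_le_energy//=.
exact: energy_le_curve_length.
Qed.
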